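(* The first-order theory of the structure $\langle\mathbb{Z},\cdot,\leqslant\rangle$ is undecidable; that is, there is no algorithm which, given a first-order sentence in the language $\{\cdot,\leqslant\}$, decides whether it is true in $\langle\mathbb{Z},\cdot,\leqslant\rangle$.
   Context: $\langle\mathbb{Z},\cdot,\leqslant\rangle$ is the first-order structure whose domain is the set of integers, with the usual multiplication and the usual (non-strict) order. *)

(* Defs.v *)
From mathcomp Require Import all_boot all_order all_algebra.
From mathcomp Require Import zify.

Set Implicit Arguments.
Unset Strict Implicit.
Unset Printing Implicit Defensive.

(** First-order logic with equality over the language {., <=}, with named
    variables x_0, x_1, ... *)

Inductive term : Type :=
| Var of nat
| Mul of term & term.

Inductive formula : Type :=
| Eq of term & term
| Le of term & term
| Not of formula
| And of formula & formula
| Or of formula & formula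
| Imp of formula & formula
| All of nat & formula
| Ex of nat & formula.

Fixpoint tvars (t : term) : seq nat :=
  match t with
  | Var x => [:: x]
  | Mul t u => tvars t ++ tvars u
  end.

Fixpoint fvars (p : formula) : seq nat :=
  match p with
  | Eq t u | Le t u => tvars t ++ tvars u
  | Not p => fvars p
  | And p q | Or p q | Imp p q => fvars p ++ fvars q
  | All x p | Ex x p => [seq y <- fvars p | y != x]
  end.

Definition sentence (p : formula) : bool := fvars p == [::].

Record structure : Type := Structure {
  dom :> Type;
  smul : dom -> dom -> dom;
  sle : dom -> dom -> Prop
}.

Fixpoint tval (M : structure) (e : nat -> M) (t : term) : M :=
  match t with
  | Var x => e x
  | Mul t u => smul (tval e t) (tval e u)
  end.

Definition upd (T : Type) (e : nat -> T) (x : nat) (a : T) : nat -> T :=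
  fun y => if y == x then a else e y.

Fixpoint sat (M : structure) (e : nat -> M) (p : formula) : Prop :=
  match p with
  | Eq t u => tval e t = tval e u
  | Le t u => sle (tval e t) (tval e u)
  | Not p => ~ sat e p
  | And p q => sat e p /\ sat e q
  | Or p q => sat e p \/ sat e q
  | Imp p q => sat e p -> sat e q
  | All x p => forall a : M, sat (upd e x a) p
  | Ex x p => exists a : M, sat (upd e x a) p
  end.

(* For a sentence the assignment is irrelevant. *)
Definition holds (M : structure) (p : formula) : Prop :=
  forall e : nat -> M, sat e p.

Definition theory (M : structure) (p : formula) : Prop :=
  sentence p /\ holds M p.

(** Algorithms are partial recursive functions: [recf n] is the type of
    programs for n-ary ones. *)

Inductive recf : nat -> Type :=
| Zero n : recf n
| Succ : recf 1
| Proj n (i : 'I_n) : recf n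
| Comp k n (f : recf k) (g : 'I_k -> recf n) : recf n
| PRec n (f : recf n) (g : recf n.+2) : recf n.+1
| Mu n (f : recf n.+1) : recf n.

(* [computes f v y]: the program f halts on input v with output y.
   In [PRec f g] the recursion argument comes first, and g receives the
   predecessor, the previous value and the parameters, in this order.
   [Mu f] searches for the least first argument at which f vanishes; f must
   halt at all the smaller ones. *)
Fixpoint computes n (f : recf n) : n.-tuple nat -> nat -> Prop :=
  match f in recf n return n.-tuple nat -> nat -> Prop with
  | Zero _ => fun _ y => y = 0
  | Succ => fun v y => y = (thead v).+1
  | Proj _ i => fun v y => y = tnth v i
  | Comp k _ f g => fun v y =>
      exists w : k.-tuple nat,
        (forall i, computes (g i) v (tnth w i)) /\ computes f w y
  | PRec _ f g => fun v y =>
      let a := [tuple of behead v] in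
      (fix rec m y := match m with
        | 0 => computes f a y
        | m'.+1 => exists z, rec m' z /\ computes g [tuple of m' :: z :: a] y
        end) (thead v) y
  | Mu _ f => fun v y =>
      computes f [tuple of y :: v] 0 /\
      forall z, z < y -> exists u, computes f [tuple of z :: v] u.+1
  end.

(** Goedel numbering. *)

(* Cantor's pairing function *)
Definition cpair (x y : nat) : nat := ((x + y) * (x + y).+1)./2 + y.

Fixpoint tcode (t : term) : nat :=
  match t with
  | Var x => cpair 0 x
  | Mul t u => cpair 1 (cpair (tcode t) (tcode u))
  end.

Fixpoint fcode (p : formula) : nat :=
  match p with
  | Eq t u => cpair 0 (cpair (tcode t) (tcode u))
  | Le t u => cpair 1 (cpair (tcode t) (tcode u))
  | Not p => cpair 2 (fcode p)
  | And p q => cpair 3 (cpair (fcode p) (fcode q))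
  | Or p q => cpair 4 (cpair (fcode p) (fcode q))
  | Imp p q => cpair 5 (cpair (fcode p) (fcode q))
  | All x p => cpair 6 (cpair x (fcode p))
  | Ex x p => cpair 7 (cpair x (fcode p))
  end.

Lemma cpair_inj x y x' y' : cpair x y = cpair x' y' -> x = x' /\ y = y'.
Proof.
have step m : (m.+1 * m.+2)./2 = (m * m.+1)./2 + m.+1.
  have -> : m.+1 * m.+2 = m * m.+1 + m.+1.*2 by lia.
  by rewrite halfD odd_double andbF add0n doubleK.
have mono m n : m < n -> (m * m.+1)./2 + m.+1 <= (n * n.+1)./2.
  by move=> lt_mn; rewrite -step; apply/half_leq/leq_mul; lia.
rewrite /cpair => E.
case: (ltngtP (x + y) (x' + y')) => [lt|lt|eq].
- by have := mono _ _ lt; lia.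
- by have := mono _ _ lt; lia.
- by rewrite eq in E; lia.
Qed.

Lemma tcode_inj : injective tcode.
Proof.
elim=> [x|t IHt u IHu] [x'|t' u'] //= /cpair_inj[] //.
- by move=> _ ->.
- by move=> _ /cpair_inj[/IHt-> /IHu->].
Qed.

Lemma fcode_inj : injective fcode.
Proof.
elim=> [t u|t u|p IHp|p IHp q IHq|p IHp q IHq|p IHp q IHq|x p IHp|x p IHp]
  [t' u'|t' u'|p'|p' q'|p' q'|p' q'|x' p'|x' p'] //= /cpair_inj[] // _.
- by move=> /cpair_inj[/tcode_inj-> /tcode_inj->].
- by move=> /cpair_inj[/tcode_inj-> /tcode_inj->].
- by move=> /IHp->.
- by move=> /cpair_inj[/IHp-> /IHq->].
- by move=> /cpair_inj[/IHp-> /IHq->].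
- by move=> /cpair_inj[/IHp-> /IHq->].
- by move=> /cpair_inj[-> /IHp->].
- by move=> /cpair_inj[-> /IHp->].
Qed.

(* The algorithm is given the code of a sentence and answers 1 (true) or
   0 (false); its behaviour on other inputs is unconstrained. *)
Definition decides (f : recf 1) (T : formula -> Prop) : Prop :=
  forall p : formula, sentence p ->
    (T p -> computes f [tuple fcode p] 1) /\
    (~ T p -> computes f [tuple fcode p] 0).

Definition decidable_theory (M : structure) : Prop :=
  exists f : recf 1, decides f (theory M).

Definition int_mul_le : structure :=
  @Structure int (fun x y => (x * y)%R) (fun x y => (x <= y)%R).

(* Main.v *)
(** In Z, |x| |y| = |z| iff (xy)^2 = z^2, and |x| <= |y| iff x^2 <= y^2, so a
    formula can speak about the absolute values of its variables only, that is
    about (N, *, <=).  There the successor is definable from <=, addition from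
    successor and product (Robinson), and Goedel's beta function codes finite
    sequences; hence the graph of every partial recursive function is
    definable.  If f decided the theory, some formula p would say of n that f
    rejects the sentence "the formula coded by n holds at n"; for n the code
    of p this sentence is true iff f rejects it. *)
Require Import Defs.
From mathcomp Require Import all_boot all_order all_algebra.
From mathcomp Require Import zify.
From Stdlib Require Import FunctionalExtensionality.

Set Implicit Arguments.
Unset Strict Implicit.
Unset Printing Implicit Defensive.

(** * Definable relations between absolute values and their closure under logic *)

Definition env := nat -> nat.

Definition shift (e : env) : env := fun i => e i.+1.

Definition absenv (e : nat -> int) (r : nat -> nat) : env := fun i => `|e (r i)|%N.

(* [r] names the free variables, so that substitution is a change of [r] and
   needs no operation on formulas.  The bound [N] on the names provides a fresh
   variable for quantification. *)
Definition definable (P : env -> Prop) : Prop :=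
  forall (r : nat -> nat) N, (forall i, r i < N) ->
  exists p : formula, all (fun x => x < N) (fvars p) /\
    forall e, sat (M := int_mul_le) e p <-> P (absenv e r).

Lemma definable_iff (P Q : env -> Prop) :
  (forall e, P e <-> Q e) -> definable P -> definable Q.
Proof.
move=> PQ dP r N rN; have [p [pN pP]] := dP r N rN.
by exists p; split=> // e; rewrite pP.
Qed.

Lemma definable_rename (s : nat -> nat) (P : env -> Prop) :
  definable P -> definable (fun e => P (fun i => e (s i))).
Proof. by move=> dP r N rN; apply: (dP (fun i => r (s i)) N). Qed.

Lemma definable_not (P : env -> Prop) :
  definable P -> definable (fun e => ~ P e).
Proof.
move=> dP r N rN; have [p [pN pP]] := dP r N rN.
by exists (Not p); split=> //= e; rewrite pP.
Qed.

Lemma definable_and (P Q : env -> Prop) :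
  definable P -> definable Q -> definable (fun e => P e /\ Q e).
Proof.
move=> dP dQ r N rN; have [p [pN pP]] := dP r N rN.
have [q [qN qQ]] := dQ r N rN.
by exists (And p q); split=> [|e] /=; rewrite ?all_cat ?pN // pP qQ.
Qed.

Lemma definable_or (P Q : env -> Prop) :
  definable P -> definable Q -> definable (fun e => P e \/ Q e).
Proof.
move=> dP dQ r N rN; have [p [pN pP]] := dP r N rN.
have [q [qN qQ]] := dQ r N rN.
by exists (Or p q); split=> [|e] /=; rewrite ?all_cat ?pN // pP qQ.
Qed.

Lemma definable_imp (P Q : env -> Prop) :
  definable P -> definable Q -> definable (fun e => P e -> Q e).
Proof.
move=> dP dQ r N rN; have [p [pN pP]] := dP r N rN.
have [q [qN qQ]] := dQ r N rN.
by exists (Imp p q); split=> [|e] /=; rewrite ?all_cat ?pN // pP qQ.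
Qed.

(** The bound variable takes the name [N], distinct from every [r i], so assigning it leaves the
    other values untouched. *)
Lemma definable_quant (P : nat -> env -> Prop) :
  definable (fun e => P (e 0) (shift e)) ->
  forall (r : nat -> nat) N, (forall i, r i < N) ->
  exists p : formula, all (fun x => x < N) [seq y <- fvars p | y != N] /\
    forall e a, sat (M := int_mul_le) (upd e N a) p <-> P `|a|%N (absenv e r).
Proof.
move=> dP r N rN.
pose r' i := if i is j.+1 then r j else N.
have r'N i : r' i < N.+1 by case: i => [|i] /=; rewrite ltnS // ltnW.
have [p [pN pP]] := dP r' N.+1 r'N.
exists p; split=> [|e a].
  apply/allP=> x; rewrite mem_filter => /andP[xN /(allP pN)] /=.
  by rewrite ltnS leq_eqVlt (negPf xN).
have -> : P `|a|%N (absenv e r) =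
    P (absenv (upd e N a) r' 0) (shift (absenv (upd e N a) r')).
  congr P; first by rewrite /absenv /upd /= eqxx.
  apply: functional_extensionality => i.
  by rewrite /absenv /shift /upd /= (ltn_eqF (rN i)).
exact: pP.
Qed.

Lemma definable_ex (P : nat -> env -> Prop) :
  definable (fun e => P (e 0) (shift e)) ->
  definable (fun e => exists a, P a e).
Proof.
move=> dP r N rN; have [p [pN pP]] := definable_quant dP rN.
exists (Ex N p); split=> //= e; split=> [[a /pP]|[a Pa]]; first by exists `|a|%N.
by exists (Posz a); apply/pP.
Qed.

Lemma definable_all (P : nat -> env -> Prop) :
  definable (fun e => P (e 0) (shift e)) ->
  definable (fun e => forall a, P a e).
Proof.
move=> dP r N rN; have [p [pN pP]] := definable_quant dP rN.
exists (All N p); split=> //= e; split=> [pe a|Pe a]; last exact/pP.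
exact/(pP e (Posz a)).
Qed.

Lemma definable_all_ord n (P : 'I_n -> env -> Prop) :
  (forall i, definable (P i)) -> definable (fun e => forall i, P i e).
Proof.
elim: n P => [|n IH] P dP.
  (* A closed tautology serves as the empty conjunction: it meets every bound on the names. *)
  move=> r N rN; exists (All 0 (Eq (Var 0) (Var 0))); split=> // e.
  by split=> // _ [].
apply: (definable_iff _ (definable_and (dP ord0)
  (IH (fun i => P (lift ord0 i)) (fun i => dP _)))) => e.
split=> [[P0 PS] i|Pe]; last by split.
by case: (unliftP ord0 i) => [j|] ->.
Qed.

(** * Definable functions and substitution *)

Definition definable_fun (F : env -> nat) : Prop :=
  definable (fun e => e 0 = F (shift e)).

(** The value of [F] is named by an existential quantifier, since no term of the language need
    denote it. *)
Lemma definable_subst (P : nat -> env -> Prop) F :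
  definable_fun F -> definable (fun e => P (e 0) (shift e)) ->
  definable (fun e => P (F e) e).
Proof.
move=> dF dP.
apply: (@definable_iff (fun e => exists a, a = F e /\ P a e)).
  by move=> e; split=> [[_ [->]]|]; last by exists (F e).
by apply: definable_ex; apply: definable_and.
Qed.

Lemma definable_fun_rename (s : nat -> nat) F :
  definable_fun F -> definable_fun (fun e => F (fun i => e (s i))).
Proof.
exact: (definable_rename (fun i => if i is j.+1 then (s j).+1 else 0)).
Qed.

Lemma definable_fun_shift F :
  definable_fun F -> definable_fun (fun e => F (shift e)).
Proof. exact: (definable_fun_rename S). Qed.

(** * Order, product, successor, addition, remainder and pairing *)

(** Squaring erases the sign: this is how atomic formulas over the integers come to compare absolute
    values. *)
Lemma sqr_absz (x : int) : (x * x)%R = (`|x| * `|x|)%N.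
Proof. by rewrite -abszM gez0_abs // -GRing.expr2 Num.Theory.sqr_ge0. Qed.

Lemma definable_le_var i j : definable (fun e => e i <= e j).
Proof.
move=> r N rN.
exists (Le (Mul (Var (r i)) (Var (r i))) (Mul (Var (r j)) (Var (r j)))).
split=> [|e] /=; first by rewrite !rN.
by rewrite !sqr_absz lez_nat !mulnn leq_sqr.
Qed.

Lemma definable_mul_var i j k : definable (fun e => e k = e i * e j).
Proof.
move=> r N rN.
pose t := Mul (Var (r i)) (Var (r j)).
exists (Eq (Mul (Var (r k)) (Var (r k))) (Mul t t)).
split=> [|e] /=; first by rewrite !rN.
rewrite /absenv !sqr_absz abszM; split=> [[/eqP]|->] //.
by rewrite !mulnn eqn_exp2r // => /eqP.
Qed.

Lemma definable_eq_var i j : definable (fun e => e i = e j).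
Proof.
apply: definable_iff
  (definable_and (definable_le_var i j) (definable_le_var j i)) => e.
lia.
Qed.

Lemma definable_var i : definable_fun (fun e => e i).
Proof. exact: definable_eq_var. Qed.

Lemma definable_eq F G :
  definable_fun F -> definable_fun G -> definable (fun e => F e = G e).
Proof. by move=> dF dG; apply: (definable_subst (P := fun a e => a = G e)). Qed.

Lemma definable_le F G :
  definable_fun F -> definable_fun G -> definable (fun e => F e <= G e).
Proof.
move=> dF dG; apply: (definable_subst (P := fun a e => a <= G e)) => //.
apply: (definable_subst (P := fun b e => e 0 <= b)).
  exact: definable_fun_shift.
exact: definable_le_var.
Qed.

Lemma definable_fun_comp2 (op : nat -> nat -> nat) F G :
  definable (fun e => e 0 = op (e 1) (e 2)) ->
  definable_fun F -> definable_fun G -> definable_fun (fun e => op (F e) (G e)).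
Proof.
move=> dop dF dG; rewrite /definable_fun.
apply: (definable_subst (P := fun b e => e 0 = op (F (shift e)) b)).
  exact: definable_fun_shift.
apply: (definable_subst (P := fun a e => e 1 = op a (e 0))).
  exact: (definable_fun_shift (definable_fun_shift dF)).
(* The two substitutions have put the first argument at index 0, the second at 1 and the output at
   2. *)
exact: (definable_rename (fun i => nth 0 [:: 2; 0; 1] i) dop).
Qed.

Lemma definable_mul F G :
  definable_fun F -> definable_fun G -> definable_fun (fun e => F e * G e).
Proof. by apply: definable_fun_comp2; apply: definable_mul_var. Qed.

(** The successor is the least number strictly above; strict order is a negated [<=]. *)
Lemma definable_succ F : definable_fun F -> definable_fun (fun e => (F e).+1).
Proof.
move=> dF; rewrite /definable_fun.
apply: (definable_subst (P := fun a e => e 0 = a.+1)).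
  exact: definable_fun_shift.
apply: (@definable_iff (fun e => ~ e 1 <= e 0 /\
    forall z, ~ z <= e 0 -> e 1 <= z)) => [e|].
  rewrite /shift; split=> [[lt /(_ (e 0).+1) le]|->]; first lia.
  by split=> [|z]; lia.
apply: definable_and; first by apply/definable_not/definable_le_var.
apply: definable_all; apply: definable_imp; last exact: definable_le_var.
by apply/definable_not/definable_le_var.
Qed.

Lemma definable_const k : definable_fun (fun=> k).
Proof.
elim: k => [|k]; last exact: definable_succ.
apply: (@definable_iff (fun e => forall z, e 0 <= z)) => [e|].
  by split=> [/(_ 0)|->]; rewrite // leqn0 => /eqP.
by apply: definable_all; apply: definable_le_var.
Qed.

(** After expansion the equation reads [(x + y) * z = z * z], and a nonzero [z] cancels. At [z = 0]
    it is vacuous, hence the separate case. *)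
Lemma robinson_add x y z :
  (z = 0 /\ x = 0 /\ y = 0) \/
  (~ z = 0 /\ (x * z).+1 * (y * z).+1 = (z * z * (x * y).+1).+1) <-> z = x + y.
Proof.
have -> : (x * z).+1 * (y * z).+1 = ((x + y) * z + z * z * (x * y)).+1 by nia.
split=> [[|[nz]]|->]; first by lia.
  have -> : z * z * (x * y).+1 = z * z + z * z * (x * y) by nia.
  by case=> /addIn/eqP; rewrite eqn_pmul2r; lia.
by case: (x + y =P 0) => [|nz]; [left|right; split=> //]; lia.
Qed.

Lemma definable_add F G :
  definable_fun F -> definable_fun G -> definable_fun (fun e => F e + G e).
Proof.
apply: definable_fun_comp2.
have dv := definable_var; have d0 := definable_const 0.
apply: (definable_iff (fun e => robinson_add (e 1) (e 2) (e 0))).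
apply: definable_or; apply: definable_and.
- exact: definable_eq.
- by apply: definable_and; apply: definable_eq.
- by apply: definable_not; apply: definable_eq.
by apply: definable_eq; repeat first
  [exact: dv | apply: definable_mul | apply: definable_succ].
Qed.

Lemma definable_modS F G : definable_fun F -> definable_fun G ->
  definable_fun (fun e => F e %% (G e).+1).
Proof.
apply: (definable_fun_comp2 (op := fun a b => a %% b.+1)).
apply: (@definable_iff (fun e => e 0 <= e 2 /\
    exists q, e 1 = q * (e 2).+1 + e 0)) => [e|].
  split=> [[le [q ->]]|->]; first by rewrite modnMDl modn_small.
  by rewrite -ltnS ltn_pmod //; split=> //; exists (e 1 %/ (e 2).+1); apply: divn_eq.
have dv := definable_var.
apply: definable_and; first exact: definable_le.
apply: definable_ex; apply: definable_eq; first exact: dv.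
by apply: definable_add; rewrite ?/shift; [apply: definable_mul; [|apply: definable_succ]|]; apply: dv.
Qed.

(** Halving is expressed by an [h] whose double is the product; it exists because one of two
    consecutive numbers is even. *)
Lemma definable_cpair F G :
  definable_fun F -> definable_fun G -> definable_fun (fun e => cpair (F e) (G e)).
Proof.
apply: definable_fun_comp2.
apply: (@definable_iff (fun e => exists h,
    h + h = (e 1 + e 2) * (e 1 + e 2).+1 /\ e 0 = h + e 2)) => [e|].
  split=> [[h [hh ->]]|->]; first by rewrite /cpair -hh addnn doubleK.
  eexists; split; last reflexivity.
  by rewrite addnn halfK oddM /= andbN subn0.
apply: definable_ex; apply: definable_and; apply: definable_eq; rewrite ?/shift;
  by repeat first [exact: definable_var | apply: definable_mul
    | apply: definable_add | apply: definable_succ].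
Qed.

(** * Goedel's beta function *)

Definition beta (a b i : nat) : nat := a %% (i.+1 * b).+1.

Lemma definable_beta A B I :
  definable_fun A -> definable_fun B -> definable_fun I ->
  definable_fun (fun e => beta (A e) (B e) (I e)).
Proof.
move=> dA dB dI; apply: definable_modS => //.
by apply: definable_mul => //; apply: definable_succ.
Qed.

(** The product [M] of the first [n] moduli is coprime to the next one, so the Chinese remainder
    theorem for two moduli adds a residue and keeps the earlier ones. *)
Lemma chinese_seq (m s : nat -> nat) n :
  (forall i j, i < j < n -> coprime (m i) (m j)) ->
  exists a, forall i, i < n -> a = s i %[mod m i].
Proof.
elim: n => [|n IH] co; first by exists 0.
have [a aP] := IH (fun i j ij => co i j ltac:(lia)).
pose M := \prod_(i < n) m i.
have coM : coprime M (m n).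
  rewrite /M; elim/big_ind: _ => [|x y|i _]; first exact: coprime1n.
    by rewrite coprimeMl => -> ->.
  by apply: co; rewrite ltn_ord ltnSn.
exists (chinese M (m n) a (s n)) => i; rewrite ltnS leq_eqVlt.
case/orP=> [/eqP->|lt_in]; first by rewrite chinese_modr.
have miM : m i %| M by rewrite /M (bigD1 (Ordinal lt_in)) //= dvdn_mulr.
by rewrite -aP // -(modn_dvdm _ miM) chinese_modl // modn_dvdm.
Qed.

(** A prime dividing two of the moduli divides [(j - i) * b] but not [b], hence divides [j - i];
    being then at most [N], it divides the factorial [b], a contradiction. *)
Lemma betaP (s : nat -> nat) n :
  exists a b, forall i, i < n -> beta a b i = s i.
Proof.
(* [N] bounds the index differences, for coprimality, and also the values, which thus stay below
   their moduli. *)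
pose N := n + \max_(i < n) s i; pose b := N`!.
have [|a aP] := @chinese_seq (fun i => (i.+1 * b).+1) s n.
  move=> i j /andP[ij jn].
  rewrite coprime_has_primes //; apply/hasPn => p; rewrite !mem_primes /=.
  case/andP=> p_pr pj; apply/negP => /andP[_ pi].
  have pb : ~~ (p %| b).
    apply/negP => pb; move: pi.
    by rewrite -addn1 dvdn_addr ?dvdn_mull // dvdn1 => /eqP p1; rewrite p1 in p_pr.
  have : p %| (j - i) * b.
    have -> : (j - i) * b = (j.+1 * b).+1 - (i.+1 * b).+1 by nia.
    exact: dvdn_sub.
  rewrite Euclid_dvdM // (negPf pb) orbF => /dvdn_leq p_le.
  case/negP: pb; apply: dvdn_fact; rewrite prime_gt0 //= /N; lia.
exists a, b => i lt_in; rewrite /beta aP // modn_small // ltnS.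
have s_le : s i <= N by rewrite /N; have := @leq_bigmax _ (fun i : 'I_n => s i) (Ordinal lt_in); rewrite /=; lia.
apply: leq_trans (leq_pmull _ _) => //.
by apply: leq_trans s_le _; apply: fact_geq.
Qed.


(** * Recursion and the graphs of partial recursive functions *)

Lemma definable_subst3 (P : nat -> nat -> nat -> env -> Prop) F G H :
  definable_fun F -> definable_fun G -> definable_fun H ->
  definable (fun e => P (e 0) (e 1) (e 2) (shift (shift (shift e)))) ->
  definable (fun e => P (F e) (G e) (H e) e).
Proof.
move=> dF dG dH dP.
apply: (definable_subst (P := fun c e => P (F e) (G e) c e)) => //.
apply: (definable_subst (P := fun b e => P (F (shift e)) b (e 0) (shift e))).
  exact: definable_fun_shift.
apply: (definable_subst
  (P := fun a e => P a (e 0) (e 1) (shift (shift e)))) => //.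
exact: definable_fun_shift (definable_fun_shift dF).
Qed.

(** Quantifying over a sequence amounts to quantifying over two numbers that code an initial segment
    of it by [beta]. *)
Lemma definable_rec (B : nat -> env -> Prop)
    (St : nat -> nat -> nat -> env -> Prop) N Y :
  definable (fun e => B (e 0) (shift e)) ->
  definable (fun e => St (e 0) (e 1) (e 2) (shift (shift (shift e)))) ->
  definable_fun N -> definable_fun Y ->
  definable (fun e => exists s : nat -> nat,
    [/\ B (s 0) e, forall m, m < N e -> St m (s m) (s m.+1) e & s (N e) = Y e]).
Proof.
move=> dB dS dN dY.
have dv := definable_var; have dsh := definable_fun_shift.
apply: (@definable_iff (fun e => exists a b,
    B (beta a b 0) e /\
    (forall m, ~ N e <= m -> St m (beta a b m) (beta a b m.+1) e) /\
    beta a b (N e) = Y e)) => [e|].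
  split=> [[a [b [B0 [BS BN]]]]|[s [B0 BS BN]]].
    by exists (beta a b); split=> // m mN; apply: BS; lia.
  (* One more than [N e], because the final value [s (N e)] must be coded too. *)
  have [a [b abP]] := betaP s (N e).+1.
  exists a, b; rewrite !abP //; split=> //; split=> // m mN.
  by rewrite !abP; [apply: BS| |]; lia.
apply: definable_ex; apply: definable_ex; apply: definable_and.
  apply: (definable_subst (P := fun c e => B c (shift (shift e)))).
    exact: (definable_beta (dv 1) (dv 0) (definable_const 0)).
  exact: (definable_rename (fun i => if i is j.+1 then j.+3 else 0) dB).
apply: definable_and; last first.
  have dY2 := dsh _ (dsh _ dY); have dN2 := dsh _ (dsh _ dN).
  exact: definable_eq (definable_beta (dv 1) (dv 0) dN2) dY2.
apply: definable_all; apply: definable_imp.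
  have dN3 := dsh _ (dsh _ (dsh _ dN)).
  exact: definable_not (definable_le dN3 (dv 0)).
apply: (definable_subst3
  (P := fun x y z e => St x y z (shift (shift (shift e))))).
- exact: dv.
- exact: (definable_beta (dv 2) (dv 1) (dv 0)).
- exact: (definable_beta (dv 2) (dv 1) (definable_succ (dv 0))).
exact: (definable_rename
  (fun i => if i is j.+3 then (j.+3).+3 else i) dS).
Qed.

(** Rewrites the recursion inside [computes] for [PRec] as the existence of a trace of values, the
    shape handled by [definable_rec]. *)
Lemma rec_trace (B : nat -> Prop) (St : nat -> nat -> nat -> Prop) n y :
  (fix rec m y := match m with
    | 0 => B y
    | m'.+1 => exists z, rec m' z /\ St m' z y
    end) n y <->
  exists s : nat -> nat,
    [/\ B (s 0), forall m, m < n -> St m (s m) (s m.+1) & s n = y].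
Proof.
elim: n y => [|n IH] y; first by split=> [By|[s [? _ <-]]]; first by exists (fun=> y).
split=> [[z [/IH[s [B0 BS sn]] Sz]]|[s [B0 BS sn]]]; last first.
  exists (s n); split; last by rewrite -sn; apply: BS.
  by apply/IH; exists s; split=> // m mn; apply: BS; lia.
exists (fun i => if i <= n then s i else y); split=> //=; last by rewrite ltnn.
move=> m; rewrite ltnS => mn; rewrite mn.
by case: (ltngtP m n) mn => // [lt _|-> _]; [apply: BS|rewrite sn].
Qed.

Definition definable_tuple n (V : env -> n.-tuple nat) : Prop :=
  forall i, definable_fun (fun e => tnth (V e) i).

Lemma definable_tuple_shift n (V : env -> n.-tuple nat) :
  definable_tuple V -> definable_tuple (fun e => V (shift e)).
Proof. by move=> dV i; apply: (definable_fun_shift (dV i)). Qed.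

Lemma definable_tuple_cons n F (V : env -> n.-tuple nat) :
  definable_fun F -> definable_tuple V ->
  definable_tuple (fun e => [tuple of F e :: V e]).
Proof.
move=> dF dV i; case: (unliftP ord0 i) => [j|] ->; last exact: dF.
rewrite /definable_fun; apply: definable_iff (dV j) => e.
by rewrite tnthS.
Qed.

Lemma definable_tuple_behead n (V : env -> n.+1.-tuple nat) :
  definable_tuple V -> definable_tuple (fun e => [tuple of behead (V e)]).
Proof.
move=> dV i; rewrite /definable_fun; apply: definable_iff (dV (inord i.+1)) => e.
by rewrite tnth_behead.
Qed.

(** Induction on the program. [Comp] codes its intermediate tuple by [beta], [PRec] passes through
    its trace, and [Mu] is a bounded quantifier. *)
Lemma definable_computes n (f : recf n) V Y :
  definable_tuple V -> definable_fun Y ->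
  definable (fun e => computes f (V e) (Y e)).
Proof.
have dv := definable_var; have dsh := definable_fun_shift.
have dtsh := definable_tuple_shift.
elim: f V Y => {n} [n||n i|k n f IHf g IHg|n f IHf g IHg|n f IHf] V Y dV dY /=.
- exact: definable_eq dY (definable_const 0).
- exact: definable_eq dY (definable_succ (dV ord0)).
- exact: definable_eq dY (dV i).
- apply: (@definable_iff (fun e => exists a b,
    (forall i : 'I_k, computes (g i) (V e) (beta a b i)) /\
    computes f [tuple beta a b i | i < k] (Y e))) => [e|].
    split=> [[a [b [gP fP]]]|[w [gP fP]]].
      by exists [tuple beta a b i | i < k]; split=> // i; rewrite tnth_mktuple.
    (* Only indices below [k] are read, so the default 0 of [nth] never shows. *)
    have [a [b abP]] := betaP (nth 0 w) k.
    exists a, b; split=> [i|]; first by rewrite abP // -tnth_nth.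
    rewrite (_ : [tuple _ | i < k] = w) //.
    by apply: eq_from_tnth => i; rewrite tnth_mktuple abP // -tnth_nth.
  apply: definable_ex; apply: definable_ex; apply: definable_and.
    apply: definable_all_ord => i; apply: IHg; first exact: (dtsh _ _ (dtsh _ _ dV)).
    exact: (definable_beta (dv 1) (dv 0) (definable_const i)).
  apply: IHf; last exact: (dsh _ (dsh _ dY)).
  move=> i; rewrite /definable_fun.
  apply: (definable_iff _ (definable_beta (dv 1) (dv 0) (definable_const i))) => e.
  by rewrite tnth_mktuple.
- apply: (definable_iff (fun e => iff_sym (rec_trace _ _ _ _))).
  have dB := definable_tuple_behead dV.
  apply: (@definable_rec
    (fun y e => computes f [tuple of behead (V e)] y)
    (fun m z y e => computes g [tuple of m :: z :: [tuple of behead (V e)]] y)) => //.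
  + exact: IHf (dtsh _ _ dB) (dv 0).
  + apply: IHg; last exact: dv.
    apply: definable_tuple_cons (dv 0) (definable_tuple_cons (dv 1) _).
    exact: (dtsh _ _ (dtsh _ _ (dtsh _ _ dB))).
  + exact: (dV ord0).
apply: definable_and.
  by apply: IHf; [apply: definable_tuple_cons|apply: definable_const].
apply: (definable_all (P := fun z e =>
  z < Y e -> exists u, computes f [tuple of z :: V e] u.+1)).
apply: definable_imp.
  exact: definable_le (definable_succ (dv 0)) (dsh _ dY).
apply: definable_ex; apply: IHf (definable_succ (dv 0)).
exact: definable_tuple_cons (dv 1) (dtsh _ _ (dtsh _ _ dV)).
Qed.

(** If two outputs of [Mu f] differed, [f] would yield both zero and a successor at the smaller
    one. *)
Lemma computes_inj n (f : recf n) v y y' :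
  computes f v y -> computes f v y' -> y = y'.
Proof.
elim: f v y y' => {n} [n||n i|k n f IHf g IHg|n f IHf g IHg|n f IHf] v y y' /=;
  try by move=> -> ->.
- case=> w [gw fw] [w' [gw' fw']].
  have ww' : w = w' by apply: eq_from_tnth => i; apply: IHg (gw i) (gw' i).
  by rewrite -ww' in fw'; apply: IHf fw fw'.
- elim: (thead v) y y' => [|m IHm] y y'; first exact: IHf.
  case=> z [mz gz] [z' [mz' gz']].
  by rewrite -(IHm _ _ mz mz') in gz'; apply: IHg gz gz'.
case=> fy lt [fy' lt'].
case: (ltngtP y y') => // [/lt'|/lt] [u fu]; first by have := IHf _ _ _ fy fu.
by have := IHf _ _ _ fy' fu.
Qed.

(** * Concrete formulas, numerals and the diagonal argument *)

(** Capping the names with [minn] bounds them yet preserves the first [N.+1], the only ones on which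
    [P] depends. *)
Lemma formula_of_definable N (P : env -> Prop) :
  definable P -> (forall e e', (forall i, i < N.+1 -> e i = e' i) -> P e -> P e') ->
  exists p : formula, all (fun x => x < N.+1) (fvars p) /\
    forall e, sat (M := int_mul_le) e p <-> P (fun i => `|e i|%N).
Proof.
move=> dP Pext; pose r i := minn i N.
have rN i : r i < N.+1 by rewrite ltnS geq_minr.
have [p [pN pP]] := dP r N.+1 rN.
exists p; split=> // e; rewrite pP.
by split; apply: Pext => i iN; rewrite /absenv /r (minn_idPl _).
Qed.

(* Otherwise conversion evaluates concrete codes in unary. *)
Local Opaque cpair.

Section Numerals.
Variables pzero psucc : formula.

(** Two variable names suffice: the predecessor is found as variable 1 and copied back, up to sign,
    to variable 0 by equality of squares, so the smaller numeral is reused without renaming. *)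
Fixpoint numeral (n : nat) : formula :=
  if n is m.+1 then
    Ex 1 (And psucc (Ex 0 (And (Eq (Mul (Var 0) (Var 0)) (Mul (Var 1) (Var 1)))
      (numeral m))))
  else pzero.

Hypothesis pzeroP : forall e, sat (M := int_mul_le) e pzero <-> `|e 0|%N = 0.
Hypothesis psuccP :
  forall e, sat (M := int_mul_le) e psucc <-> `|e 0|%N = `|e 1|%N.+1.

Lemma sat_numeral n e : sat (M := int_mul_le) e (numeral n) <-> `|e 0|%N = n.
Proof.
elim: n e => [|n IH] e /=; first exact: pzeroP.
split=> [[b [/psuccP + [a [ab /IH]]]]|en].
  rewrite /upd /= => -> a_n; congr _.+1.
  move: ab; rewrite /upd /= !sqr_absz a_n; case=> /eqP.
  by rewrite !mulnn eqn_exp2r // => /eqP.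
exists (Posz n); split; first exact/psuccP.
by exists (Posz n); split=> //; apply/IH.
Qed.

Hypothesis pzero_fv : all (fun x => x < 1) (fvars pzero).
Hypothesis psucc_fv : all (fun x => x < 2) (fvars psucc).

Lemma numeral_fv n : all (fun x => x < 1) (fvars (numeral n)).
Proof.
elim: n => //= n IH; apply/allP => x; rewrite !(mem_filter, mem_cat, inE) /=.
case/andP=> x1 /orP[/(allP psucc_fv) /=|]; first by lia.
by rewrite (negPf x1) /= => /andP[_ /(allP IH)].
Qed.

Lemma definable_numeral_code :
  definable_fun (fun e => fcode (numeral (e 0))).
Proof.
(* [h] takes the code of a numeral to the code of the next one, so the codes form a recursive
   sequence. *)
pose h c := cpair 7 (cpair 1 (cpair 3 (cpair (fcode psucc) (cpair 7 (cpair 0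
  (cpair 3 (cpair
    (fcode (Eq (Mul (Var 0) (Var 0)) (Mul (Var 1) (Var 1)))) c))))))).
apply: (@definable_iff (fun e => exists s : nat -> nat,
  [/\ s 0 = fcode pzero, forall m, m < e 1 -> s m.+1 = h (s m) & s (e 1) = e 0])).
  move=> e; rewrite /shift; split=> [[s [s0 sS <-]]|->].
    have: e 1 <= e 1 by [].
    (* Induction on an index at most [e 1], since [s] obeys the recursion only up to there. *)
    elim: {1 3 4}(e 1) => // m IH lt_m.
    by rewrite (sS _ lt_m) (IH (ltnW lt_m)).
  by exists (fun m => fcode (numeral m)).
have dv := definable_var.
apply: (@definable_rec (fun y _ => y = fcode pzero) (fun _ z y _ => y = h z)).
- exact: definable_eq (dv 0) (definable_const _).
- apply: definable_eq; first exact: dv.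
  by repeat first [exact: dv | exact: definable_const | apply: definable_cpair].
- exact: dv.
- exact: dv.
Qed.

End Numerals.

Theorem mainTheorem2 : ~ decidable_theory int_mul_le.
Proof.
case=> f fP.
have [||pzero [pzero_fv pzeroP]] := @formula_of_definable 0 (fun e => e 0 = 0).
- exact: definable_eq (definable_var 0) (definable_const 0).
- by move=> e e' <-.
have [||psucc [psucc_fv psuccP]] :=
  @formula_of_definable 1 (fun e => e 0 = (e 1).+1).
- exact: definable_eq (definable_var 0) (definable_succ (definable_var 1)).
- by move=> e e' ee'; rewrite !ee'.
pose num := numeral pzero psucc.
(* If [n] codes a formula, [diag n] codes the claim that it holds at [n]; binding variable 0 next to
   a numeral replaces substitution. *)
pose diag n := cpair 7 (cpair 0 (cpair 3 (cpair (fcode (num n)) n))).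
have [||p [p_fv pP]] :=
  @formula_of_definable 0 (fun e => computes f [tuple diag (e 0)] 0).
- apply: definable_computes; last exact: definable_const.
  apply: definable_tuple_cons; last by case.
  by repeat first [apply: definable_numeral_code | exact: definable_var
    | exact: definable_const | apply: definable_cpair].
- by move=> e e' <-.
pose q := Ex 0 (And (num (fcode p)) p).
have q_sent : sentence q.
  rewrite /sentence -size_eq0 -leqn0 leqNgt -has_predT; apply/hasPn => x.
  rewrite mem_filter mem_cat => /andP[x0 /orP[]].
    by move/(allP (numeral_fv pzero_fv psucc_fv _)) => /=; lia.
  by move/(allP p_fv) => /=; lia.
(* By computation [fcode q] is [diag (fcode p)], so [q] asserts its own rejection by [f]. *)
have qP e : sat (M := int_mul_le) e q <-> computes f [tuple fcode q] 0.
  split=> [[a [/(sat_numeral pzeroP psuccP) an /pP]]|fq]; first by rewrite an.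
  exists (Posz (fcode p)); split; first exact/(sat_numeral pzeroP psuccP).
  exact/pP.
have [f1 f0] := fP q q_sent.
(* Were [q] true, [f] would answer 1, whereas [q] says that it answers 0. *)
have nT : ~ theory int_mul_le q.
  move=> T; have := computes_inj (f1 T); case: T => _ /(_ (fun=> 0%R))/qP fq.
  by move=> /(_ _ fq).
(* As [q] is not true, [f] answers 0, which is what [q] says. *)
by apply: (nT); split=> // e; apply/qP/f0.
Qed.
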